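(* Let $\mu$ be a countably additive non-negative Borel measure of bounded variation (i.e. finite) on $\mathbb{R}$, let $u\in L^2(\mathbb{R},\mu,\mathbb{C})$, and let $\mu_u=|u|^2\mu$, i.e. $\mu_u(A)=\int_A|u(x)|^2\,d\mu(x)$ for every Borel set $A\subset\mathbb{R}$. Suppose that $$\limsup_{\xi\to\infty}|\hat\mu_u(\xi)|<\|\mu_u\|.$$ Then: 1. the restricted dynamical system $\mathbf{\Phi}|_{\mathbb{T}_u}$ is not topologically transitive; 2. every point $v\in\mathbb{T}_u$ is wandering for $\mathbf{\Phi}|_{\mathbb{T}_u}$.
   Context: $\hat\nu(\xi)=\int_{\mathbb{R}}e^{-i\xi x}\,d\nu(x)$ denotes the Fourier transform of a finite Borel measure $\nu$ on $\mathbb{R}$, and $\|\nu\|$ its total variation (so $\|\nu\|=\nu(\mathbb{R})$ if $\nu\ge 0$). The linear flow $\mathbf{\Phi}=\{\mathbf{\Phi}_t\}_{t\in\mathbb{R}}$ on $H=L^2(\mathbb{R},\mu,\mathbb{C})$ is $(\mathbf{\Phi}_tv)(x)=e^{itx}v(x)$. The invariant torus of $u$ is $\mathbb{T}_u=\{v\in H: |v(x)|=|u(x)|\text{ for }\mu\text{-a.e. }x\}$, with the topology induced from the norm of $H$; it is invariant under $\mathbf{\Phi}$. The restricted system $\mathbf{\Phi}|_{\mathbb{T}_u}$ is topologically transitive if some trajectory $\{\mathbf{\Phi}_tv: t\in\mathbb{R}\}$ with $v\in\mathbb{T}_u$ is dense in $\mathbb{T}_u$. A point $v$ is wandering for a flow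 if there exist a neighborhood $O(v)$ of $v$ in the space on which the flow acts and a time $T>0$ such that $\mathbf{\Phi}_t(O(v))\cap O(v)=\emptyset$ for all $t>T$. *)

(* Defs.v *)
From HB Require Import structures.
From mathcomp Require Import all_boot all_order all_algebra.
From mathcomp Require Import generic_quotient ring_quotient complex.
From mathcomp Require Import all_classical all_reals all_analysis.
From mathcomp Require Import measurable_realfun measurable_fun_approximation.
Import Order.TTheory GRing.Theory Num.Theory.
Import numFieldNormedType.Exports.

Set Implicit Arguments.
Unset Strict Implicit.
Unset Printing Implicit Defensive.

Export ComplexField.Normc.

Local Open Scope classical_set_scope.
Local Open Scope ring_scope.
Local Open Scope complex_scope.
Local Open Scope quotient_scope.

Section ComplexL2.
Context d (T : measurableType d) (R : realType).
Variable mu : {measure set T -> \bar R}.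

Definition complex_measurable (f : T -> R[i]) : Prop :=
  measurable_fun [set: T] (fun x => complex.Re (f x)) /\
  measurable_fun [set: T] (fun x => complex.Im (f x)).

Definition eL2norm (f : T -> R[i]) : \bar R :=
  'N[mu]_(2%:E)[EFin \o (@normc R \o f)]%E.

Definition L2pred : {pred T -> R[i]} :=
  mem [set f | complex_measurable f /\ (eL2norm f < +oo)%E].

Lemma normc_ge0 (z : R[i]) : 0 <= normc z.
Proof. by case: z => a b /=; exact: sqrtr_ge0. Qed.

Lemma measurable_normc (f : T -> R[i]) :
  complex_measurable f -> measurable_fun [set: T] (fun x => normc (f x)).
Proof.
move=> [mr mi].
rewrite (_ : (fun x => _) =
  Num.sqrt \o (fun x => complex.Re (f x) ^+ 2 + complex.Im (f x) ^+ 2)).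
  apply: measurableT_comp.
    by apply: continuous_measurable_fun; exact: sqrt_continuous.
  by apply: measurable_funD; exact: measurable_funX.
by apply/funext => x /=; case: (f x).
Qed.

Lemma le_eL2norm (f : T -> R[i]) (g : T -> R) :
  complex_measurable f -> measurable_fun [set: T] g ->
  (forall x, normc (f x) <= g x) ->
  (eL2norm f <= 'N[mu]_(2%:E)[EFin \o g])%E.
Proof.
move=> mf mg fg; rewrite /eL2norm unlock.
have mpow (h : T -> R) : measurable_fun [set: T] h ->
    measurable_fun [set: T] (fun x => `| (h x)%:E | `^ 2)%E.
  move=> mh; apply: (@measurableT_comp _ _ _ _ _ _ (fun x => x `^ 2)%E) => //=.
    exact: measurable_poweR.
  by apply/measurable_EFinP; exact: measurableT_comp.
have ge0 (h : T -> R) : (0 <= \int[mu]_x (`| (h x)%:E | `^ 2))%E.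
  by apply: integral_ge0 => x _; exact: poweR_ge0.
apply: gt0_ler_poweR; rewrite ?invr_ge0 ?ler0n ?in_itv /= ?leey ?andbT ?ge0//.
apply: ge0_le_integral => //.
- by apply: mpow; exact: measurable_normc.
- exact: mpow.
move=> x _; rewrite lee_fin ge0_ler_powR ?ler0n ?nnegrE//.
by rewrite !ger0_norm ?normc_ge0// (le_trans (normc_ge0 _) (fg x)).
Qed.

Lemma complex_measurableB (f g : T -> R[i]) :
  complex_measurable f -> complex_measurable g -> complex_measurable (f - g).
Proof.
move=> [f1 f2] [g1 g2]; split.
  rewrite (_ : (fun x => _) =
    (fun x => complex.Re (f x)) \- (fun x => complex.Re (g x))).
    exact: measurable_funB.
  by apply/funext => x; rewrite /= !fctE; case: (f x) (g x) => [a b] [a' b'].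
rewrite (_ : (fun x => _) =
  (fun x => complex.Im (f x)) \- (fun x => complex.Im (g x))).
  exact: measurable_funB.
by apply/funext => x; rewrite /= !fctE; case: (f x) (g x) => [a b] [a' b'].
Qed.

Lemma complex_measurableM (f g : T -> R[i]) :
  complex_measurable f -> complex_measurable g ->
  complex_measurable (fun x => f x * g x).
Proof.
move=> [f1 f2] [g1 g2]; split.
  rewrite (_ : (fun x => _) =
    (fun x => complex.Re (f x) * complex.Re (g x)
              - complex.Im (f x) * complex.Im (g x))).
    by apply: measurable_funB; exact: measurable_funM.
  by apply/funext => x /=; case: (f x) (g x) => [a b] [a' b'].
rewrite (_ : (fun x => _) =
  (fun x => complex.Re (f x) * complex.Im (g x)
            + complex.Im (f x) * complex.Re (g x))).
  by apply: measurable_funD; exact: measurable_funM.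
by apply/funext => x /=; case: (f x) (g x) => [a b] [a' b'].
Qed.

Lemma le_eL2normB (f g : T -> R[i]) :
  complex_measurable f -> complex_measurable g ->
  (eL2norm (f - g)%R <= eL2norm f + eL2norm g)%E.
Proof.
move=> mf mg.
apply: (le_trans
  (@le_eL2norm (f - g) (fun x => normc (f x) + normc (g x)) _ _ _)).
- exact: complex_measurableB.
- by apply: measurable_funD; exact: measurable_normc.
- move=> x; have := @le_normcD R (f x) (- g x); rewrite normcN; exact.
apply: eminkowski; [exact: measurable_normc|exact: measurable_normc|].
by rewrite lee_fin ler1n.
Qed.

Lemma eL2norm0 : eL2norm 0 = 0%E.
Proof.
rewrite /eL2norm (_ : EFin \o _ = cst 0%E) ?Lnorm0//.
  by apply/funext => x; congr EFin; exact: normc0.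
Qed.

Lemma L2pred_zmod_closed : zmod_closed L2pred.
Proof.
split.
  rewrite inE /=; split; last by rewrite eL2norm0.
  by split; exact: measurable_cst.
move=> f g; rewrite !inE /= => -[mf ff] [mg gg]; split.
  exact: complex_measurableB.
by apply: (le_lt_trans (le_eL2normB mf mg)); rewrite lte_add_pinfty.
Qed.

HB.instance Definition _ :=
  GRing.isZmodClosed.Build (T -> R[i]) L2pred L2pred_zmod_closed.

Record L2fun := MkL2fun {
  L2fun_val :> T -> R[i] ;
  L2fun_valP : L2fun_val \in L2pred }.

HB.instance Definition _ := [isSub of L2fun for L2fun_val].
HB.instance Definition _ := [Choice of L2fun by <:].
HB.instance Definition _ := [SubChoice_isSubZmodule of L2fun by <:].

Lemma L2fun_measurable (f : L2fun) : complex_measurable f.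
Proof. by have := L2fun_valP f; rewrite inE => -[]. Qed.

Lemma L2fun_lty (f : L2fun) : (eL2norm f < +oo)%E.
Proof. by have := L2fun_valP f; rewrite inE => -[]. Qed.

Definition L2null : {pred L2fun} :=
  mem [set f : L2fun | {ae mu, forall x, f x = 0}].

Lemma L2null_zmod_closed : zmod_closed L2null.
Proof.
split; first by rewrite inE /=; exact: aeW.
move=> f g; rewrite !inE /=; apply: filterS2 => x fx gx.
by rewrite -[LHS]/(f x - g x) fx gx subrr.
Qed.

HB.instance Definition _ :=
  GRing.isZmodClosed.Build L2fun L2null L2null_zmod_closed.

(* The elements of L2 mu are classes of square-integrable functions modulo
   mu-a.e. equality; a class coerces to one of its representatives, so its
   values are only meaningful up to mu-null sets (see L2_funK, eq_L2). *)
Definition L2 : Type := Quotient.quot L2null.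
HB.instance Definition _ := GRing.Zmodule.on L2.
HB.instance Definition _ := EqQuotient.on L2.

Definition L2_fun (f : L2) : L2fun := repr f.
Coercion L2_fun : L2 >-> L2fun.

Lemma L2_funK (f : L2fun) : {ae mu, forall x, (\pi_L2 f : L2) x = f x}.
Proof.
have : (repr (\pi_L2 f : L2) - f) \in L2null.
  by rewrite Quotient.idealrBE reprK.
rewrite inE /=; apply: filterS => x.
by rewrite -[X in X = 0]/(_ x - f x) => /eqP; rewrite subr_eq0 => /eqP.
Qed.

Lemma eq_L2 (f g : L2fun) :
  {ae mu, forall x, f x = g x} -> \pi_L2 f = \pi_L2 g :> L2.
Proof.
move=> fg; apply/eqP; rewrite -Quotient.idealrBE inE /=.
by apply: filterS fg => x fgx; rewrite -[LHS]/(f x - g x) fgx subrr.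
Qed.

Lemma eq_eL2norm (f g : L2fun) :
  {ae mu, forall x, f x = g x} -> eL2norm f = eL2norm g.
Proof.
move=> fg; rewrite /eL2norm unlock; congr (_ `^ _)%E.
have mpow (h : L2fun) : measurable_fun [set: T]
    (fun x => `| (EFin \o (@normc R \o h)) x | `^ 2)%E.
  apply: (@measurableT_comp _ _ _ _ _ _ (fun x => x `^ 2)%E) => //=.
    exact: measurable_poweR.
  apply/measurable_EFinP; apply: measurableT_comp => //.
  exact/measurable_normc/L2fun_measurable.
apply: ae_eq_integral => //; apply: filterS fg => x fgx _.
by rewrite /= fgx.
Qed.

Lemma eL2norm_fin (f : L2fun) : eL2norm f \is a fin_num.
Proof. by rewrite ge0_fin_numE ?L2fun_lty//; exact: Lnorm_ge0. Qed.

Definition L2_norm (f : L2) : R := fine (eL2norm f).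

Lemma L2_norm_pi (f : L2fun) : L2_norm (\pi_L2 f) = fine (eL2norm f).
Proof. by congr fine; apply: eq_eL2norm; exact: L2_funK. Qed.

Lemma L2_norm_ind (P : L2 -> Prop) : (forall f : L2fun, P (\pi_L2 f)) ->
  forall f, P f.
Proof. by move=> Pf f; rewrite -[f]reprK. Qed.

Lemma L2_piB (f g : L2fun) : \pi_L2 f - \pi_L2 g = \pi_L2 (f - g).
Proof. by rewrite !piE. Qed.

Lemma L2_piMn (f : L2fun) n : (\pi_L2 f) *+ n = \pi_L2 (f *+ n).
Proof.
elim: n => [|n ih]; first by rewrite !mulr0n !piE.
by rewrite !mulrS ih !piE.
Qed.

Lemma L2_normB (f g : L2) : L2_norm (f - g) <= L2_norm f + L2_norm g.
Proof.
elim/L2_norm_ind: f => f; elim/L2_norm_ind: g => g.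
rewrite L2_piB !L2_norm_pi -lee_fin EFinD !fineK ?eL2norm_fin//.
by apply: le_eL2normB; exact: L2fun_measurable.
Qed.

Lemma L2_norm0 : L2_norm 0 = 0.
Proof.
have -> : 0 = \pi_L2 (0 : L2fun) :> L2 by rewrite !piE.
by rewrite L2_norm_pi -[RHS]/(fine 0%E) -eL2norm0.
Qed.

Lemma L2_normN (f : L2) : L2_norm (- f) = L2_norm f.
Proof.
have h (g : L2) : L2_norm (- g) <= L2_norm g.
  by rewrite -[- g]add0r (le_trans (L2_normB _ _))// L2_norm0 add0r.
by apply/eqP; rewrite eq_le h /=; have := h (- f); rewrite opprK.
Qed.

Lemma L2_normD (f g : L2) : L2_norm (f + g) <= L2_norm f + L2_norm g.
Proof. by have := L2_normB f (- g); rewrite opprK L2_normN. Qed.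

Lemma L2_norm0_eq0 (f : L2) : L2_norm f = 0 -> f = 0.
Proof.
elim/L2_norm_ind: f => f; rewrite L2_norm_pi => /eqP.
rewrite -eqe fineK ?eL2norm_fin// => /eqP f0.
have -> : 0 = \pi_L2 (0 : L2fun) :> L2 by rewrite !piE.
apply: eq_L2.
have mf : measurable_fun [set: T] (EFin \o (@normc R \o f)).
  by apply/measurable_EFinP; exact/measurable_normc/L2fun_measurable.
have := Lnorm_eq0_eq0 mf _ f0; rewrite lte_fin ltr0n => /(_ isT).
by apply: filterS => x /(_ I) [] /eq0_normc.
Qed.

Lemma L2_normMn (f : L2) n : L2_norm (f *+ n) = L2_norm f *+ n.
Proof.
elim/L2_norm_ind: f => f; rewrite L2_piMn !L2_norm_pi.
have Nf : @normc R \o f \in Lfun mu 2%:E.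
  rewrite inE; apply/andP; split; rewrite inE/=.
    exact/measurable_normc/L2fun_measurable.
  exact: L2fun_lty.
have p1 : (1 <= 2%:E :> \bar R)%E by rewrite lee_fin ler1n.
rewrite -(Lnormr_natmul (Lfun_Sub p1 Nf)); congr fine.
congr Lnorm; apply/funext => x /=; congr EFin.
have L2fun_valMn m : L2fun_val (f *+ m) x = f x *+ m.
  by elim: m => [|m ih]; rewrite ?mulr0n// !mulrS -ih.
have LfunMn m : (Lfun_Sub p1 Nf *+ m : T -> R) x = normc (f x) *+ m.
  elim: m => [|m ih]; rewrite ?mulr0n//.
  by rewrite (mulrS (Lfun_Sub p1 Nf)) (mulrS (normc (f x))) -ih.
by rewrite LfunMn L2fun_valMn; exact: (@normcMn R (f x)).
Qed.

HB.instance Definition _ := @Num.Zmodule_isNormed.Build R L2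
  L2_norm L2_normD L2_norm0_eq0 L2_normMn L2_normN.
(* The topology of L2 mu is the one of its norm. *)
HB.instance Definition _ := PseudoMetric.copy L2 (pseudoMetric_normed L2).
HB.instance Definition _ := isPointed.Build L2 0.
HB.instance Definition _ := NormedZmod_PseudoMetric_eq.Build R L2 erefl.

Definition sqnorm_measure (u : L2) (A : set T) : \bar R :=
  (\int[mu]_(x in A) ((normc (u x)) ^+ 2)%:E)%E.

Section sqnorm_measure_instances.
Variable u : L2.

Let sqnorm0 : sqnorm_measure u set0 = 0%E.
Proof. exact: integral_set0. Qed.

Let sqnorm_ge0 A : (0 <= sqnorm_measure u A)%E.
Proof. by apply: integral_ge0 => x _; rewrite lee_fin sqr_ge0. Qed.

Let mu2 : measurable_fun [set: T] (fun x => ((normc (u x)) ^+ 2)%:E).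
Proof.
apply/measurable_EFinP; apply: measurable_funX.
exact/measurable_normc/L2fun_measurable.
Qed.

Let sqnorm_sigma_additive : semi_sigma_additive (sqnorm_measure u).
Proof.
by apply: semi_sigma_additive_nng_induced => // x; rewrite lee_fin sqr_ge0.
Qed.

HB.instance Definition _ := isMeasure.Build _ _ _ (sqnorm_measure u)
  sqnorm0 sqnorm_ge0 sqnorm_sigma_additive.

Let sqnorm_fin : fin_num_fun (sqnorm_measure u).
Proof.
apply: lty_fin_num_fun.
rewrite -[ltLHS]/(sqnorm_measure u setT).
suff -> : sqnorm_measure u setT = (eL2norm u `^ 2)%E.
  by rewrite poweR_lty// L2fun_lty.
rewrite /eL2norm poweR_Lnorm ?pnatr_eq0//; apply: eq_integral => x _.
by rewrite /= powR_mulrn// ger0_norm ?normc_ge0.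
Qed.

HB.instance Definition _ :=
  Measure_isFinite.Build _ _ _ (sqnorm_measure u) sqnorm_fin.

End sqnorm_measure_instances.

End ComplexL2.

Section Fourier.
Context (R : realType).

Definition expi (t : R) : R[i] := cos t +i* sin t.

Definition complex_integral
    (nu : {finite_measure set (measurableTypeR R) -> \bar R})
    (f : R -> R[i]) : R[i] :=
  (\int[nu]_x complex.Re (f x)) +i* (\int[nu]_x complex.Im (f x)).

Definition fourier (nu : {finite_measure set (measurableTypeR R) -> \bar R})
    (xi : R) : R[i] :=
  complex_integral nu (fun x => expi (- (xi * x))).

End Fourier.

Section LinearFlow.
Context (R : realType) (mu : {measure set (measurableTypeR R) -> \bar R}).

Lemma normc_expi (t : R) : normc (expi t) = 1.
Proof. by rewrite /= cos2Dsin2 sqrtr1. Qed.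

Lemma complex_measurable_expi (t : R) :
  @complex_measurable _ (measurableTypeR R) R (fun x : R => expi (t * x)).
Proof.
have mt : measurable_fun [set: measurableTypeR R] (fun x : R => t * x).
  exact: measurable_funM.
split.
  apply: (@measurableT_comp _ _ _ _ _ _ (@cos R)) => //.
  by apply: continuous_measurable_fun; exact: continuous_cos.
apply: (@measurableT_comp _ _ _ _ _ _ (@sin R)) => //.
by apply: continuous_measurable_fun; exact: continuous_sin.
Qed.

Definition modulate (t : R) (v : R -> R[i]) : R -> R[i] :=
  fun x => expi (t * x) * v x.

Lemma normc_modulate t (v : R -> R[i]) x : normc (modulate t v x) = normc (v x).
Proof. by rewrite /modulate normcM normc_expi mul1r. Qed.

Lemma modulate_L2 t (v : L2fun mu) : modulate t v \in L2pred mu.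
Proof.
rewrite inE /=; split.
  apply: complex_measurableM; last exact: L2fun_measurable.
  exact: complex_measurable_expi.
suff -> : eL2norm mu (modulate t v) = eL2norm mu v by exact: L2fun_lty.
by apply: eq_Lnorm => x /=; rewrite normc_modulate.
Qed.

Definition Phi (t : R) (v : L2 mu) : L2 mu :=
  \pi_(L2 mu) (MkL2fun (modulate_L2 t v)).

Definition torus (u : L2 mu) : set (L2 mu) :=
  [set v | {ae mu, forall x, normc (v x) = normc (u x)}].

Lemma Phi_torus (u : L2 mu) t (v : torus u) : Phi t (\val v) \in torus u.
Proof.
case: v => v /= /[!inE] /= vu.
apply: filterS2 vu (L2_funK (MkL2fun (modulate_L2 t v))) => x <- ->.
exact: normc_modulate.
Qed.

(* The restricted flow acts on the type attached to the set torus u, whose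
   topology is the one induced by L2 mu. *)
Definition Phi_restr (u : L2 mu) (t : R) (v : torus u) : torus u :=
  exist _ (Phi t (\val v)) (Phi_torus t v).

End LinearFlow.

Section Dynamics.
Context (R : realType) (X : topologicalType).
Implicit Types phi : R -> X -> X.

Definition trajectory phi (v : X) : set X := [set phi t v | t in [set: R]].

Definition topologically_transitive phi := exists v, dense (trajectory phi v).

Definition wandering phi (v : X) := exists2 O : set X, nbhs v O &
  exists2 T : R, 0 < T & forall t, T < t -> (phi t @` O) `&` O = set0.

End Dynamics.

(* Main.v *)
Require Import Defs.
From mathcomp Require Import all_boot all_order all_algebra complex.
From mathcomp Require Import all_classical all_reals all_analysis.
From mathcomp Require Import generic_quotient measurable_realfun ring lra.
Import Order.TTheory GRing.Theory Num.Theory.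
Import numFieldNormedType.Exports.

Set Implicit Arguments.
Unset Strict Implicit.
Unset Printing Implicit Defensive.

Local Open Scope classical_set_scope.
Local Open Scope ring_scope.

(** Write [nu] for [|u|^2 mu], [A] for its mass and [a t] for the integral of
    [cos (t x)] against [nu], the real part of the Fourier transform.  Since
    [|e^(iy) - s|^2 = 1 + s^2 - 2 s cos y] for real [s], every [v] in the torus
    satisfies
      [|Phi t v - v|^2 = 2 (A - a t)]  and  [|Phi t v + v|^2 = 2 (A + a t)]
    (both are cases of [sqr_norm_PhiB]): these distances depend on [v] only
    through [nu].  The hypothesis on the limsup yields [c < A] and [T > 0] with
    [a t <= c] for [t > T].

    Wandering: after time [T] the flow moves every point of the torus by at
    least the same positive distance [r = sqrt (2 (A - c))], so no point of a
    ball of radius [r / 2] can return to that ball ([Phi_wandering]).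

    Failure of transitivity: the torus contains [- v] together with [v], and
    the trajectory of [v] stays away from [- v], i.e. [A + a t] is bounded below
    by a positive constant ([massDcosine_transform_ge]).  Indeed, if [Phi t v] were
    close to [- v], then [Phi (2 k t) v] would be close to [v] for moderate [k];
    this is the inequality [1 - cos (2 k y) <= 4 k^2 (1 + cos y)] integrated
    against [nu].  It is impossible once [2 k |t| > T].  A fixed [k] achieves
    this for all [t] outside a neighbourhood of [0], and for [t] near [0] the
    value [a t] is close to [a 0 = A > 0] by dominated convergence. *)

(** * Trigonometric inequalities *)

Lemma normr_sin_natmul (R : realType) (k : nat) (y : R) :
  `|sin (k%:R * y)| <= k%:R * `|sin y|.
Proof.
elim: k => [|k ih]; first by rewrite !mul0r sin0 normr0.
rewrite -natr1 !mulrDl !mul1r sinD.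
apply: (le_trans (ler_normD _ _)); apply: lerD; rewrite normrM.
  by apply: (le_trans _ ih); rewrite ler_piMr// ler_norml cos_geN1 cos_le1.
by rewrite ler_piMl// ler_norml cos_geN1 cos_le1.
Qed.

(** Quantitative form of the fact that [e^(iy)] close to [-1] forces
    [e^(2iky)] close to [1]: the left side is [2 sin^2 (k y)], at most
    [2 k^2 sin^2 y = 2 k^2 (1 - cos y) (1 + cos y)]. *)
Lemma one_sub_cos_even_natmul_le (R : realType) (k : nat) (y : R) :
  1 - cos (k.*2%:R * y) <= 4 * k%:R ^+ 2 * (1 + cos y).
Proof.
have -> : k.*2%:R * y = (k%:R * y) *+ 2.
  by rewrite -mulr_natl -muln2 natrM; ring.
rewrite cos_mulr2n.
have /(lerXn2r 2) := normr_sin_natmul k y.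
rewrite !nnegrE normr_ge0 mulr_ge0// => /(_ isT isT).
rewrite exprMn !real_normK ?num_real// => sk.
have := cos2Dsin2 (k%:R * y); have := cos2Dsin2 y => s1 s2.
have c1 := cos_geN1 y; have c2 := cos_le1 y.
have : k%:R ^+ 2 * sin y ^+ 2 <= k%:R ^+ 2 * (2 * (1 + cos y)).
  by apply: ler_wpM2l; [exact: sqr_ge0|nra].
rewrite mulr2n; lra.
Qed.

Lemma sqr_normc_expiB (R : realType) (y s : R) :
  normc (expi y - s%:C%C) ^+ 2 = 1 + s ^+ 2 - 2 * s * cos y.
Proof.
rewrite /= sqr_sqrtr; last by rewrite addr_ge0 ?sqr_ge0.
have := cos2Dsin2 y; rewrite oppr0 addr0; nra.
Qed.

(** * The cosine transform of a finite measure *)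

Section cosine_transform.
Context (R : realType).
Variable nu : {finite_measure set (measurableTypeR R) -> \bar R}.

Definition cosine_transform (t : R) : R := \int[nu]_x cos (t * x).

Local Notation mass := (fine (nu [set: R])).

Lemma integrable_cos (t : R) :
  nu.-integrable [set: R] (EFin \o (fun x => cos (t * x))).
Proof.
apply: measurable_bounded_integrable => //.
- by rewrite ltey_eq fin_num_measure.
- exact: (complex_measurable_expi t).1.
exists 1; split => // M M1 x _ /=.
by rewrite (le_trans _ (ltW M1))// ler_norml cos_geN1 cos_le1.
Qed.

Lemma integrable_affine_cos (p q t : R) :
  nu.-integrable [set: R] (EFin \o (fun x => p + q * cos (t * x))).
Proof.
have h := integrableD measurableT
  (finite_measure_integrable_cst nu p measurableT)
  (integrableZl measurableT q (integrable_cos t)).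
exact: eq_integrable h.
Qed.

Lemma Re_fourierE t : complex.Re (fourier nu t) = cosine_transform t.
Proof. by apply: eq_Rintegral => x _; rewrite /= cosN. Qed.

Lemma cosine_transformN t : cosine_transform (- t) = cosine_transform t.
Proof. by apply: eq_Rintegral => x _; rewrite mulNr cosN. Qed.

Lemma cosine_transform0 : cosine_transform 0 = mass.
Proof.
transitivity (\int[nu]_(x in [set: measurableTypeR R]) (1 : R)).
  by apply: eq_Rintegral => x _; rewrite mul0r cos0.
by rewrite Rintegral_cst// mul1r.
Qed.

Lemma integral_affine_cos (p q t : R) :
  \int[nu]_x (p + q * cos (t * x)) = p * mass + q * cosine_transform t.
Proof.
rewrite RintegralD//.
- by rewrite Rintegral_cst// RintegralZl//; exact: integrable_cos.
- exact: finite_measure_integrable_cst.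
- exact: integrableZl (integrable_cos t).
Qed.

Lemma cosine_transform_even_natmul (k : nat) (t : R) :
  mass - cosine_transform (k.*2%:R * t) <=
  4 * k%:R ^+ 2 * (mass + cosine_transform t).
Proof.
have := integral_affine_cos 1 (-1) (k.*2%:R * t).
rewrite mul1r mulN1r => <-.
rewrite mulrDr -integral_affine_cos; apply: le_Rintegral => //.
- exact: integrable_affine_cos.
- exact: integrable_affine_cos.
- move=> x _; rewrite -mulrA mulN1r; apply: (le_trans (one_sub_cos_even_natmul_le _ _)).
  by rewrite mulrDr mulr1.
Qed.

Lemma cvg_cosine_transform0 : cosine_transform t @[t --> 0] --> mass.
Proof.
rewrite -cosine_transform0.
(* the interval ]-1, 1[ stands for any open interval around 0 *)
apply: (@continuity_under_integral R _ _ nu (fun t x => cos (t * x))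
  setT _ (-1) 1 _ _ (cst 1)) => //.
- by move=> t _; exact: integrable_cos.
- apply: aeW => x _ t _; apply: continuous_comp; last exact: continuous_cos.
  exact: mulrr_continuous.
- exact: finite_measure_integrable_cst.
- by move=> t _; apply: aeW => x _; rewrite ler_norml cos_geN1 cos_le1.
- by rewrite inE /= in_itv /= ltrN10 ltr01.
Qed.

(** If the cosine transform is eventually bounded away from its maximum [mass],
    then it is bounded away from [- mass] at all times.  Continuity handles
    the times [|t| < r]; for the others one multiple [2 k] with [2 k r > T]
    carries [t] beyond [T], where [cosine_transform_even_natmul] gives
    [mass - c <= 4 k^2 (mass + cosine_transform t)]. *)
Lemma massDcosine_transform_ge (c T : R) : 0 <= c < mass ->
  (forall t, T < t -> cosine_transform t <= c) ->
  exists2 e : R, 0 < e & forall t, e <= mass + cosine_transform t.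
Proof.
move=> /andP[c0 cm] cT; have m0 : 0 < mass by exact: le_lt_trans cm.
have : \forall t \near 0, 0 < cosine_transform t.
  exact: (cvgr_gt _ cvg_cosine_transform0).
case=> r /= r0 near_r.
pose k := (Num.truncn (T / (2 * r))).+1.
have k0 : (0 : R) < k%:R by rewrite ltr0n.
have kr : T < k.*2%:R * r.
  have : T / (2 * r) < k%:R by exact: truncnS_gt.
  rewrite ltr_pdivrMr ?mulr_gt0// -muln2 natrM; lra.
exists (Num.min mass ((mass - c) / (4 * k%:R ^+ 2))).
  by rewrite lt_min m0 divr_gt0 ?subr_gt0// mulr_gt0// exprn_gt0.
move=> t; wlog t0 : t / 0 <= t.
  have [|t0] := leP 0 t; first by move=> ? /(_ t); exact.
  by rewrite -(cosine_transformN t); apply; rewrite oppr_ge0 ltW.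
rewrite ge_min; have [tr|rt] := ltP t r.
  have : 0 < cosine_transform t.
    by apply: near_r; rewrite /= sub0r normrN ger0_norm.
  by move=> /ltW at0; rewrite lerDl at0.
apply/orP; right.
rewrite ler_pdivrMr ?mulr_gt0 ?exprn_gt0//.
have := cosine_transform_even_natmul k t.
have : cosine_transform (k.*2%:R * t) <= c.
  by apply: cT; apply: (lt_le_trans kr); rewrite ler_wpM2l.
lra.
Qed.

Lemma Re_le_normc (z : R[i]) : complex.Re z <= normc z.
Proof.
case: z => a b /=; rewrite (le_trans (ler_norm a))// -sqrtr_sqr.
by rewrite ler_sqrt ?lerDl ?addr_ge0 ?sqr_ge0.
Qed.

(** The limsup is an infimum of suprema over sets containing a half-line; one of
    these suprema is already below the total mass and serves as [c]. *)
Lemma cosine_transform_le_of_limf_esup :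
  (limf_esup (fun xi : R => (normc (fourier nu xi))%:E) (pinfty_nbhs R)
    < nu [set: R])%E ->
  exists c T : R, [/\ 0 <= c < mass, 0 < T &
    forall t, T < t -> cosine_transform t <= c].
Proof.
have nufin : nu [set: R] \is a fin_num by exact: fin_num_measure.
move=> /ereal_inf_lt[_ [V [M [_ MV]] <-]] supV.
have supP t : M < t -> ((normc (fourier nu t))%:E <=
    ereal_sup [set (normc (fourier nu xi))%:E | xi in V])%E.
  by move=> /MV Vt; apply: ereal_sup_ubound; exists t.
have sup0 : (0 <= ereal_sup [set (normc (fourier nu xi))%:E | xi in V])%E.
  apply: (le_trans _ (supP (M + 1) _)); last by rewrite ltrDl.
  by rewrite lee_fin normc_ge0.
move: sup0 supV supP; case: (ereal_sup _) => [c| |] //; last first.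
  by move=> _; rewrite ltNge leey.
rewrite lee_fin => c0 cnu supP; exists c, (Num.max 1 M); split.
- by rewrite c0 -lte_fin fineK.
- by rewrite lt_max ltr01.
move=> t; rewrite gt_max => /andP[_ /supP]; rewrite lee_fin; apply: le_trans.
by rewrite -Re_fourierE Re_le_normc.
Qed.

End cosine_transform.

(** * Integration against the measure with density |u|^2 *)

Section sqnorm_density.
Context d (T : measurableType d) (R : realType).
Variable mu : {finite_measure set T -> \bar R}.

Lemma sqnorm_measure_dominates (u : L2 mu) : sqnorm_measure u `<< mu.
Proof.
apply/null_content_dominatesP => A mA A0; apply: null_set_integral => //.
apply: (measurable_funS measurableT) => //; apply/measurable_EFinP.
by apply: measurable_funX; exact/measurable_normc/L2fun_measurable.
Qed.

(** By uniqueness, [|u|^2] is a.e. the Radon-Nikodym derivative of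
    [sqnorm_measure u], so this is the change of variables along that
    derivative. *)
Lemma ge0_integral_sqnorm_measure (u : L2 mu) (f : T -> \bar R) :
  measurable_fun [set: T] f -> (forall x, 0 <= f x)%E ->
  (\int[sqnorm_measure u]_x f x = \int[mu]_x (f x * (normc (u x) ^+ 2)%:E))%E.
Proof.
move=> mf f0; have dom := sqnorm_measure_dominates u.
rewrite -(Radon_Nikodym_SigmaFinite.change_of_variables dom)//.
have mu2 : measurable_fun [set: T] (fun x => (normc (u x) ^+ 2)%:E).
  apply/measurable_EFinP; apply: measurable_funX.
  exact/measurable_normc/L2fun_measurable.
have irn := Radon_Nikodym_SigmaFinite.f_integrable dom.
apply: ae_eq_integral => //.
- by apply: emeasurable_funM => //; exact: measurable_int irn.
- exact: emeasurable_funM.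
apply: ae_eqe_mul2l.
apply: integral_ae_eq => // A _ mA.
by rewrite -Radon_Nikodym_SigmaFinite.f_integral.
Qed.

Lemma sqr_norm_pi (f : L2fun mu) :
  ((`|\pi_(L2 mu)%qT f| ^+ 2)%:E = \int[mu]_x (normc (f x) ^+ 2)%:E)%E.
Proof.
rewrite -[`|_|]/(L2_norm _) L2_norm_pi.
transitivity (eL2norm mu f `^ 2)%E.
  rewrite -[in RHS](fineK (eL2norm_fin f)) /= powR_mulrn//.
  by rewrite fine_ge0// Lnorm_ge0.
rewrite /eL2norm poweR_Lnorm ?pnatr_eq0//; apply: eq_integral => x _.
by rewrite /= powR_mulrn// ger0_norm ?normc_ge0.
Qed.

End sqnorm_density.

(** * The linear flow on the torus *)

Lemma ltr_sqrt_sqr (R : rcfType) (x y : R) :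
  0 <= x -> x < Num.sqrt y -> x ^+ 2 < y.
Proof.
move=> x0 xy; have y0 : 0 < y by rewrite -sqrtr_gt0 (le_lt_trans x0).
by rewrite -[ltRHS]sqr_sqrtr ?(ltW y0)// ltrXn2r ?nnegrE ?sqrtr_ge0.
Qed.

Section flow.
Context (R : realType).
Context (mu : {finite_measure set (measurableTypeR R) -> \bar R}).
Variable u : L2 mu.

Local Notation mass := (fine (sqnorm_measure u [set: R])).

(** Pointwise [|e^(itx) v - s v|^2 = |e^(itx) - s|^2 |u|^2] a.e., so the squared
    norm is an integral of an affine function of [cos (t x)] against the measure
    with density [|u|^2].  The cases [s = 1] and [s = -1] give the distances of
    [Phi t v] to [v] and to [- v]. *)
Lemma sqr_norm_PhiB (t s : R) (v w : L2 mu) : torus u v ->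
  {ae mu, forall x, w x = s%:C%C * v x} ->
  `|Phi t v - w| ^+ 2 =
  (1 + s ^+ 2) * mass - 2 * s * cosine_transform (sqnorm_measure u) t.
Proof.
move=> vu wv; rewrite -mulNr -integral_affine_cos.
set p := 1 + s ^+ 2; set q := - (2 * s).
have pqE x : p + q * cos (t * x) = normc (expi (t * x) - s%:C%C) ^+ 2.
  by rewrite sqr_normc_expiB mulNr.
have mpq : measurable_fun [set: measurableTypeR R]
    (fun x : R => p + q * cos (t * x)).
  apply/measurable_EFinP.
  exact: measurable_int (integrable_affine_cos (sqnorm_measure u) p q t).
apply: EFin_inj.
rewrite /Rintegral fineK; last first.
  exact: integrable_fin_num (integrable_affine_cos _ p q t).
rewrite ge0_integral_sqnorm_measure; last 2 first.
- exact/measurable_EFinP.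
- by move=> x; rewrite lee_fin pqE sqr_ge0.
rewrite -[w]reprK L2_piB sqr_norm_pi; apply: ae_eq_integral => //.
- apply/measurable_EFinP; apply: measurable_funX.
  exact/measurable_normc/L2fun_measurable.
- apply/measurable_EFinP; apply: measurable_funM => //; apply: measurable_funX.
  exact/measurable_normc/L2fun_measurable.
apply: filterS2 vu wv => x /= vu wv _; congr EFin.
rewrite -vu pqE -exprMn -normcM mulrBl; congr (normc _ ^+ 2).
by rewrite -[LHS]/(expi (t * x) * v x - w x) wv.
Qed.

Lemma sqr_norm_PhiB_id (t : R) (v : L2 mu) : torus u v ->
  `|Phi t v - v| ^+ 2 = 2 * (mass - cosine_transform (sqnorm_measure u) t).
Proof.
move=> vu; rewrite (@sqr_norm_PhiB t 1 v v)//; first by ring.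
by apply: aeW => x; rewrite mul1r.
Qed.

Lemma L2_funN (v : L2 mu) : {ae mu, forall x, (- v : L2 mu) x = - v x}.
Proof.
have -> : - v = \pi_(L2 mu)%qT (- repr v) by rewrite -[v in LHS]reprK !piE.
exact: L2_funK.
Qed.

Lemma torusN (v : L2 mu) : torus u v -> torus u (- v).
Proof.
by move=> /=; apply: filterS2 (L2_funN v) => x -> <-; rewrite normcN.
Qed.

Lemma sqr_norm_PhiBN (t : R) (v : L2 mu) : torus u v ->
  `|Phi t v - (- v)| ^+ 2 = 2 * (mass + cosine_transform (sqnorm_measure u) t).
Proof.
move=> vu; rewrite (@sqr_norm_PhiB t (-1) v (- v))//; first by ring.
by apply: filterS (L2_funN v) => x ->; rewrite rmorphN1 mulN1r.
Qed.

(** A dense trajectory of [v] would enter every ball around [- v]. *)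
Lemma Phi_not_transitive (e : R) : 0 < e ->
  (forall t, e <= mass + cosine_transform (sqnorm_measure u) t) ->
  ~ topologically_transitive (@Phi_restr R mu u).
Proof.
move=> e0 he [[v vu] dv]; have vu' : torus u v := set_mem vu.
have Nvu : - v \in torus u by rewrite inE; exact: torusN.
pose B := \val @^-1` (ball (- v) (Num.sqrt (2 * e))) : set (torus u).
have oB : open B.
  by exists (ball (- v) (Num.sqrt (2 * e))) => //; exact: ball_open.
have [||_ [/[swap] [[t _ <-]]]] := dv B => //.
  exists (exist _ (- v) Nvu) => /=; apply: ballxx.
  by rewrite sqrtr_gt0 mulr_gt0.
rewrite /B /= -ball_normE /ball_ /= distrC => /(ltr_sqrt_sqr (normr_ge0 _)).
rewrite (sqr_norm_PhiBN t vu') ltr_pM2l// => lt_e.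
by have := lt_le_trans lt_e (he t); rewrite ltxx.
Qed.

(** After time [T] the displacement of every point of the torus is at least
    [r], whereas two points of a ball of radius [r / 2] are less than [r]
    apart. *)
Lemma Phi_wandering (c T : R) : c < mass -> 0 < T ->
  (forall t, T < t -> cosine_transform (sqnorm_measure u) t <= c) ->
  forall v : torus u, wandering (@Phi_restr R mu u) v.
Proof.
move=> cm T0 hc v; pose r := Num.sqrt (2 * (mass - c)).
have r0 : 0 < r by rewrite sqrtr_gt0 mulr_gt0// subr_gt0.
exists (\val @^-1` (ball (\val v) (r / 2)) : set (torus u)).
  apply: open_nbhs_nbhs; split; last by apply: ballxx; rewrite divr_gt0.
  by exists (ball (\val v) (r / 2)) => //; exact: ball_open.
exists T => // t Tt; rewrite -subset0 => _ [[w /= vw <-]] /= vPw.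
have : `|Phi t (\val w) - \val w| < r.
  by have := ball_splitr vPw vw; rewrite -ball_normE.
move=> /(ltr_sqrt_sqr (normr_ge0 _)).
rewrite sqr_norm_PhiB_id; last exact: set_mem (valP w).
have := hc _ Tt; lra.
Qed.

End flow.

Theorem theorem3p5 (R : realType)
    (mu : {finite_measure set (measurableTypeR R) -> \bar R}) (u : L2 mu) :
  (limf_esup (fun xi : R => (normc (fourier (sqnorm_measure u) xi))%:E)
     (pinfty_nbhs R) < sqnorm_measure u [set: R])%E ->
  ~ topologically_transitive (@Phi_restr R mu u) /\
  (forall v : torus u, wandering (@Phi_restr R mu u) v).
Proof.
move=> /cosine_transform_le_of_limf_esup[c [T [c0m T0 hc]]].
have /andP[_ cm] := c0m.
split; last exact: Phi_wandering cm T0 hc.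
have [e e0 he] := massDcosine_transform_ge c0m hc.
exact: Phi_not_transitive e0 he.
Qed.
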